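(* Let $Q(\cdot)$ be a finite quasigroup and let $k\in Q$ be such that the track $\varphi_k$ of $Q(\cdot)$ is special. Then for every $\alpha\in\mathrm{Aut}\,Q(\cdot)$: (a) $\alpha(k)=k$; (b) $\varphi_k\alpha=\alpha\varphi_k$; (c) $\varphi_k(k)=\alpha(\varphi_k(k))$.
   Context: $Q=\{1,2,\ldots,n\}$ is a finite set and $Q(\cdot)$ is a quasigroup on $Q$ (for all $a,b\in Q$ the equations $a\cdot x=b$ and $y\cdot a=b$ have unique solutions). Permutations are composed by $\varphi\psi(x)=\varphi(\psi(x))$. For $i\in Q$, the track $\varphi_i$ of $Q(\cdot)$ is the permutation of $Q$ determined by $x\cdot\varphi_i(x)=i$ for all $x\in Q$. For a permutation $\varphi$ of $Q$, $Z(\varphi)$ denotes the cycle type of $\varphi$, i.e. the multiset $[k_1,\ldots,k_r]$ of the lengths of all cycles of $\varphi$ (fixed points included as cycles of length 1). A track $\varphi_k$ is called special if $Z(\varphi_k)\neq Z(\varphi_i)$ for all $i\in Q$, $i\neq k$. $\mathrm{Aut}\,Q(\cdot)$ is the group of automorphisms of $Q(\cdot)$, i.e. permutations $\alpha$ of $Q$ with $\alpha(x\cdot y)=\alpha(x)\cdot\alpha(y)$ for all $x,y\in Q$. *)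

(* Defs.v *)
From mathcomp Require Import all_boot all_fingroup.
From mathcomp Require Import finmap multiset.

Set Implicit Arguments.
Unset Strict Implicit.
Unset Printing Implicit Defensive.

Record quasigroup (Q : Type) := Quasigroup {
  qmul :> Q -> Q -> Q;
  qmul_ldiv : forall a b, exists! x, qmul a x = b;
  qmul_rdiv : forall a b, exists! y, qmul y a = b
}.

Section FiniteQuasigroup.

Variables (Q : finType) (m : quasigroup Q).

Lemma qmul_ldiv_ex (a b : Q) : exists x, m a x == b.
Proof. by have [x [mx _]] := qmul_ldiv m a b; exists x; apply/eqP. Qed.

Definition qldiv (a b : Q) : Q := xchoose (qmul_ldiv_ex a b).

Lemma qldivK (a b : Q) : m a (qldiv a b) = b.
Proof. exact/eqP/(xchooseP (qmul_ldiv_ex a b)). Qed.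

Lemma track_inj (i : Q) : injective (fun x => qldiv x i).
Proof.
move=> x y eq_xy; have [z [_ z_uniq]] := qmul_rdiv m (qldiv x i) i.
by rewrite -(z_uniq x (qldivK x i)) -(z_uniq y) // eq_xy qldivK.
Qed.

Definition track (i : Q) : {perm Q} := perm (@track_inj i).

Lemma trackP (i x : Q) : m x (track i x) = i.
Proof. by rewrite permE qldivK. Qed.

Lemma track_unique (i : Q) (s : {perm Q}) :
  (forall x, m x (s x) = i) -> s = track i.
Proof.
move=> sP; apply/permP=> x; have [z [_ z_uniq]] := qmul_ldiv m x i.
by rewrite -(z_uniq _ (sP x)) -(z_uniq _ (trackP i x)).
Qed.

(* [porbits s] contains the orbits of the fixed points of [s] as singletons. *)
Definition cycle_type (s : {perm Q}) : {mset nat}%mset :=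
  seq_mset [seq #|pred_of_set C| | C <- enum (porbits s)].

Definition special_track (k : Q) : Prop :=
  forall i : Q, i <> k -> cycle_type (track k) <> cycle_type (track i).

Definition qAut : {set {perm Q}} :=
  [set a : {perm Q} | [forall x, forall y, a (m x y) == m (a x) (a y)]].

Lemma qAutP (a : {perm Q}) :
  reflect (forall x y, a (m x y) = m (a x) (a y)) (a \in qAut).
Proof.
rewrite inE; apply: (iffP forallP) => [aM x y | aM x].
  exact/eqP/(forallP (aM x)).
by apply/forallP=> y; apply/eqP.
Qed.

Lemma qAut_group_set : group_set qAut.
Proof.
apply/group_setP; split=> [|a b /qAutP aM /qAutP bM]; apply/qAutP=> x y.
  by rewrite !perm1.
by rewrite !permM aM bM.
Qed.

Canonical qAut_group := Group qAut_group_set.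

End FiniteQuasigroup.

(* The library composes permutations left to right: [(s * t) x = t (s x)];
   here [comp_perm f g x = f (g x)]. *)
Definition comp_perm (Q : finType) (f g : {perm Q}) : {perm Q} := (g * f)%g.

Lemma comp_permE (Q : finType) (f g : {perm Q}) (x : Q) : comp_perm f g x = f (g x).
Proof. exact: permM. Qed.

(* Main.v *)
Require Import Defs.
From mathcomp Require Import all_boot all_fingroup.
From mathcomp Require Import multiset.

(** Applying an automorphism $\alpha$ to $x\cdot\varphi_i(x)=i$ shows that
    $\varphi_{\alpha(i)}=\alpha\varphi_i\alpha^{-1}$ ([track_qAut]). Conjugate permutations have the
    same cycle type ([cycle_typeJ]), so a special $\varphi_k$ forces $\alpha(k)=k$. Then
    $\varphi_k=\alpha\varphi_k\alpha^{-1}$, which is (b), and evaluating at the fixed point $k$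
    gives (c). *)

Lemma porbitJ (T : finType) (s a : {perm T}) (x : T) :
  porbit (s ^ a)%g (a x) = [set a y | y in porbit s x].
Proof.
apply/setP=> z; apply/porbitP/imsetP=> [[i ->]|[y /porbitP[i ->] ->]].
  by exists ((s ^+ i)%g x); [rewrite mem_porbit | rewrite -conjXg permJ].
by exists i; rewrite -conjXg permJ.
Qed.

Lemma porbitsJ (T : finType) (s a : {perm T}) :
  porbits (s ^ a)%g = [set [set a y | y in pred_of_set C] | C in porbits s].
Proof.
apply/setP=> D; apply/imsetP/imsetP=> [[x _ ->]|[_ /imsetP[x _ ->] ->]].
  exists (porbit s ((a^-1)%g x)); first exact: imset_f.
  by rewrite -porbitJ permKV.
by exists (a x); rewrite ?porbitJ.
Qed.

(** Conjugation by [a] relabels points, so [a] maps the orbits of [s] bijectively onto those of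
    [s ^ a], preserving their sizes. *)
Lemma cycle_typeJ (Q : finType) (s a : {perm Q}) :
  cycle_type (s ^ a)%g = cycle_type s.
Proof.
have imset_a_inj : injective (fun C : {set Q} => [set a y | y in C]).
  exact/imset_inj/perm_inj.
apply/eq_seq_msetP; rewrite porbitsJ.
(* The two lists may order the orbits differently; multisets only need agreement up to
   permutation. *)
have enumE : perm_eq (enum [set [set a y | y in pred_of_set C] | C in porbits s])
    [seq [set a y | y in pred_of_set C] | C <- enum (porbits s)].
  apply: uniq_perm; rewrite ?(map_inj_uniq imset_a_inj) ?enum_uniq // => D.
  rewrite mem_enum; apply/imsetP/mapP=> -[C CP ->]; exists C => //.
    by rewrite mem_enum.
  by rewrite -mem_enum.
apply: perm_trans (perm_map _ enumE) _; rewrite -map_comp.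
rewrite (eq_map (g := fun C : {set Q} => #|C|)) // => C /=.
exact/card_imset/perm_inj.
Qed.

Lemma track_qAut (Q : finType) (m : quasigroup Q) (a : {perm Q}) (i : Q) :
  a \in qAut m -> track m (a i) = (track m i ^ a)%g.
Proof.
move=> /qAutP aM; apply/esym/track_unique=> x.
(* Writing [x] as the image under [a] of its preimage lets [a] be pulled out of the product. *)
by rewrite -(permKV a x) permJ -aM trackP.
Qed.

Theorem lemma1p4 (Q : finType) (m : quasigroup Q) (k : Q)
    (hk : special_track m k) (alpha : {perm Q}) (halpha : alpha \in qAut m) :
  [/\ alpha k = k,
      comp_perm (track m k) alpha = comp_perm alpha (track m k) &
      track m k k = alpha (track m k k)].
Proof.
have ak : alpha k = k.
  apply/eqP/negPn/negP=> /eqP /hk; apply.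
  by rewrite track_qAut // cycle_typeJ.
have trackJ : (track m k ^ alpha)%g = track m k by rewrite -track_qAut // ak.
(* For (c), [alpha (track m k k)] is the conjugate track evaluated at [alpha k], and both are
   unchanged by [alpha]. *)
by split; rewrite // /comp_perm; [rewrite [RHS]conjgC trackJ | rewrite -permJ trackJ ak].
Qed.
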